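(* Let $W_{\mathbb Q}=\mathbb Q[\mathbb R_+^\times]$ and let $\theta:W_{\mathbb Q}\to\mathbb R$ be the ring homomorphism $\theta(\sum_i a_i[x_i])=\sum_i a_ix_i$. The space $\mathrm{Ker}(\theta)/\mathrm{Ker}(\theta)^2$ is the infinite dimensional $\mathbb R$-vector space $\Omega$ generated by the symbols $\varepsilon(x)$, $x\in\mathbb R$, with relations $$\begin{aligned} (A):\ & \varepsilon(1-x)=\varepsilon(x) && (x\in\mathbb R),\\ (B):\ & \varepsilon(x+y)=\varepsilon(y)+(1-y)\,\varepsilon\Big(\frac{x}{1-y}\Big)+y\,\varepsilon\Big(-\frac xy\Big) && (x\in\mathbb R,\ y\in\mathbb R\setminus\{0,1\}),\\ (C):\ & x\,\varepsilon(1/x)=-\varepsilon(x) && (x\in\mathbb R\setminus\{0\}), \end{aligned}$$ the symbol $\varepsilon(x)$ corresponding to the class of $s(x)=1-[x]-[1-x]\in\mathrm{Ker}(\theta)$.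
   Context: $\mathbb R_+^\times$ is the multiplicative group of positive real numbers, $\mathbb Q[\mathbb R_+^\times]$ its rational group ring, and $[x]$ denotes the group-ring element associated to $x>0$; the symbol is extended to $\mathbb R$ by $[0]=0$ and $[-x]=-[x]$. The real vector space structure of $\mathrm{Ker}(\theta)/\mathrm{Ker}(\theta)^2$ comes from its structure of module over $W_{\mathbb Q}/\mathrm{Ker}(\theta)\cong\mathbb R$ (isomorphism induced by $\theta$). *)

(* Defs.v *)
From HB Require Import structures.
From mathcomp Require Import all_boot all_order all_algebra.
From mathcomp Require Import generic_quotient ring_quotient.
From mathcomp Require Import boolp reals.
From mathcomp Require Import finmap monalg.

Set Implicit Arguments.
Unset Strict Implicit.
Unset Printing Implicit Defensive.

Import Order.TTheory GRing.Theory Num.Theory.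
Local Open Scope ring_scope.
Local Open Scope quotient_scope.

(* In multinomials, {malg F[G]} only carries a product when G is a monoid
   without nontrivial units, so the convolution product of a group algebra is
   defined here, on top of the additive group {malg F[G]} of finitely supported
   functions G -> F, in which << c *g g >> stands for c[g]. *)
Section SumOverSupport.
Variables (K : choiceType) (A V : zmodType) (f : K -> {additive A -> V}).

Lemma msum_widen (d : {fset K}) (w : {malg A[K]}) : (msupp w `<=` d)%fset ->
  \sum_(k <- msupp w) f k w@_k = \sum_(k <- d) f k w@_k.
Proof.
move=> le; apply: big_fset_incl => // k _ kw.
by rewrite mcoeff_outdom ?raddf0.
Qed.

Lemma msum_is_additive :
  zmod_morphism (fun w : {malg A[K]} => \sum_(k <- msupp w) f k w@_k).
Proof.
move=> x y /=.
rewrite (msum_widen (msuppB_le x y)) (msum_widen (fsubsetUl _ (msupp y))).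
rewrite (msum_widen (fsubsetUr (msupp x) _)) -sumrB.
by apply: eq_bigr => k _; rewrite mcoeffB raddfB.
Qed.

Lemma msumU c k :
  \sum_(i <- msupp << c *g k >>) f i << c *g k >>@_i = f k c.
Proof. by rewrite (msum_widen msuppU_le) big_seq_fset1 mcoeffUU. Qed.

End SumOverSupport.

Section GroupAlgebra.
Variables (F : nzRingType) (G : groupType).

Definition group_algebra : Type := {malg F[G]}.
HB.instance Definition _ := GRing.Zmodule.on group_algebra.

Definition ga_one : group_algebra := << 1 *g 1%g >>.

Definition ga_mul (x y : group_algebra) : group_algebra :=
  \sum_(g <- msupp x) \sum_(h <- msupp y) << x@_g * y@_h *g (g * h)%g >>.

Let ga_mulr_term (a : F) (g h : G) (b : F) : group_algebra :=
  << a * b *g (g * h)%g >>.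

Let ga_mulr_term_additive a g h : zmod_morphism (ga_mulr_term a g h).
Proof. by move=> b c; rewrite /ga_mulr_term mulrBr raddfB. Qed.

HB.instance Definition _ a g h :=
  GRing.isZmodMorphism.Build F group_algebra (ga_mulr_term a g h)
    (ga_mulr_term_additive a g h).

Let ga_mull_term (y : group_algebra) (g : G) (a : F) : group_algebra :=
  \sum_(h <- msupp y) ga_mulr_term a g h y@_h.

Let ga_mull_term_additive y g : zmod_morphism (ga_mull_term y g).
Proof.
move=> a b; rewrite /ga_mull_term -sumrB; apply: eq_bigr => h _.
by rewrite /ga_mulr_term mulrBl raddfB.
Qed.

HB.instance Definition _ y g :=
  GRing.isZmodMorphism.Build F group_algebra (ga_mull_term y g)
    (ga_mull_term_additive y g).

Let ga_mull y x := ga_mul x y.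

Lemma ga_mulBl y : zmod_morphism (ga_mull y).
Proof.
by move=> u v; exact: (msum_is_additive (fun g => ga_mull_term y g) u v).
Qed.

Lemma ga_mulBr x : zmod_morphism (ga_mul x).
Proof.
move=> u v; rewrite /ga_mul -sumrB; apply: eq_bigr => g _.
exact: (msum_is_additive (fun h => ga_mulr_term x@_g g h) u v).
Qed.

HB.instance Definition _ y :=
  GRing.isZmodMorphism.Build group_algebra group_algebra (ga_mull y)
    (ga_mulBl y).
HB.instance Definition _ x :=
  GRing.isZmodMorphism.Build group_algebra group_algebra (ga_mul x)
    (ga_mulBr x).

Lemma ga_mulUU c g d h :
  ga_mul << c *g g >> << d *g h >> = << c * d *g (g * h)%g >>.
Proof.
rewrite /ga_mul (msumU (fun g => ga_mull_term << d *g h >> g)).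
exact: (msumU (fun k => ga_mulr_term c g k)).
Qed.

Lemma ga_mul_suml I (r : seq I) (E : I -> group_algebra) y :
  ga_mul (\sum_(i <- r) E i) y = \sum_(i <- r) ga_mul (E i) y.
Proof. exact: (raddf_sum (ga_mull y)). Qed.

Lemma ga_mul_sumr I (r : seq I) (E : I -> group_algebra) x :
  ga_mul x (\sum_(i <- r) E i) = \sum_(i <- r) ga_mul x (E i).
Proof. exact: (raddf_sum (ga_mul x)). Qed.

Lemma ga_mulA : associative ga_mul.
Proof.
move=> x y z; rewrite [x]monalgE ga_mul_suml (ga_mul_suml _ _ y) ga_mul_suml.
apply: eq_bigr => i _; set xi := << _ *g i >>.
rewrite [y]monalgE (ga_mul_suml _ _ z) (ga_mul_sumr _ _ xi).
rewrite (ga_mul_sumr _ _ xi) ga_mul_suml.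
apply: eq_bigr => j _; set yj := << _ *g j >>.
rewrite [z]monalgE (ga_mul_sumr _ _ yj) (ga_mul_sumr _ _ xi).
rewrite (ga_mul_sumr _ _ (ga_mul xi yj)); apply: eq_bigr => k _.
by rewrite !ga_mulUU mulrA mulgA.
Qed.

Lemma ga_mul1 : left_id ga_one ga_mul.
Proof.
move=> x; rewrite [x]monalgE ga_mul_sumr; apply: eq_bigr => i _.
by rewrite ga_mulUU mul1r mul1g.
Qed.

Lemma ga_mulr1 : right_id ga_one ga_mul.
Proof.
move=> x; rewrite [x]monalgE ga_mul_suml; apply: eq_bigr => i _.
by rewrite ga_mulUU mulr1 mulg1.
Qed.

Lemma ga_mulDl : left_distributive ga_mul +%R.
Proof. by move=> x y z; exact: (raddfD (ga_mull z)). Qed.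

Lemma ga_mulDr : right_distributive ga_mul +%R.
Proof. by move=> x y z; exact: (raddfD (ga_mul x)). Qed.

Lemma ga_one_neq0 : ga_one != 0.
Proof. by rewrite /ga_one monalgU_eq0 oner_eq0. Qed.

HB.instance Definition _ := GRing.Zmodule_isNzRing.Build group_algebra
  ga_mulA ga_mul1 ga_mulr1 ga_mulDl ga_mulDr ga_one_neq0.

End GroupAlgebra.

Section PositiveReals.
Variable R : realType.

Record posR := PosR { posR_val : R; _ : 0 < posR_val }.

HB.instance Definition _ := [isSub for posR_val].
HB.instance Definition _ := [Choice of posR by <:].

Lemma posR_gt0 (x : posR) : 0 < val x. Proof. exact: valP. Qed.

Definition posR_one : posR := PosR ltr01.
Definition posR_mul (x y : posR) : posR :=
  PosR (mulr_gt0 (posR_gt0 x) (posR_gt0 y)).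
Definition posR_inv (x : posR) : posR :=
  PosR (etrans (invr_gt0 _) (posR_gt0 x)).

Lemma posR_mulA : associative posR_mul.
Proof. by move=> x y z; apply: val_inj; rewrite /= mulrA. Qed.
Lemma posR_mulC : commutative posR_mul.
Proof. by move=> x y; apply: val_inj; rewrite /= mulrC. Qed.
Lemma posR_mul1 : left_id posR_one posR_mul.
Proof. by move=> x; apply: val_inj; rewrite /= mul1r. Qed.
Lemma posR_mulr1 : right_id posR_one posR_mul.
Proof. by move=> x; rewrite posR_mulC posR_mul1. Qed.
Lemma posR_mulV : left_inverse posR_one posR_inv posR_mul.
Proof.
by move=> x; apply: val_inj; rewrite /= mulVf // gt_eqF // posR_gt0.
Qed.
Lemma posR_mulrV : right_inverse posR_one posR_inv posR_mul.
Proof. by move=> x; rewrite posR_mulC posR_mulV. Qed.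

HB.instance Definition _ := isGroup.Build posR
  posR_mulA posR_mul1 posR_mulr1 posR_mulV posR_mulrV.

End PositiveReals.

Section Theta.
Variable R : realType.

Definition WQ : Type := group_algebra rat (posR R).
HB.instance Definition _ := GRing.NzRing.on WQ.

Lemma WQ_mulC : commutative (@GRing.mul WQ).
Proof.
move=> x y; rewrite [x]monalgE [y]monalgE.
rewrite [LHS]ga_mul_suml [RHS]ga_mul_sumr; apply: eq_bigr => i _.
rewrite ga_mul_suml ga_mul_sumr; apply: eq_bigr => j _.
by rewrite !ga_mulUU mulrC [(i * j)%g]posR_mulC.
Qed.

HB.instance Definition _ :=
  GRing.PzRing_hasCommutativeMul.Build WQ WQ_mulC.

Definition theta (w : WQ) : R := \sum_(x <- msupp w) ratr w@_x * val x.

Let theta_term (x : posR R) (a : rat) : R := ratr a * val x.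

Let theta_term_additive x : zmod_morphism (theta_term x).
Proof. by move=> a b; rewrite /theta_term raddfB mulrBl. Qed.

HB.instance Definition _ x :=
  GRing.isZmodMorphism.Build rat R (theta_term x) (theta_term_additive x).

Lemma theta_is_additive : zmod_morphism theta.
Proof.
by move=> u v; exact: (msum_is_additive (fun x => theta_term x) u v).
Qed.

HB.instance Definition _ :=
  GRing.isZmodMorphism.Build WQ R theta theta_is_additive.

Lemma thetaU c x : theta << c *g x >> = ratr c * val x.
Proof. exact: (msumU (fun x => theta_term x)). Qed.

Lemma theta_is_multiplicative : monoid_morphism theta.
Proof.
split=> [|x y]; first by rewrite [1]/(ga_one _ _) thetaU rmorph1 mul1r.
rewrite [x]monalgE [y]monalgE [X in theta X]ga_mul_suml !raddf_sum mulr_suml.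
apply: eq_bigr => i _; rewrite ga_mul_sumr raddf_sum mulr_sumr.
apply: eq_bigr => j _; rewrite ga_mulUU.
by rewrite /= !thetaU rmorphM mulrACA.
Qed.

HB.instance Definition _ :=
  GRing.isMonoidMorphism.Build WQ R theta theta_is_multiplicative.

(* [x] for real x, with [0] = 0 and [- x] = - [x] *)
Definition bracket (x : R) : WQ :=
  if insub x is Some p then << p >>
  else if insub (- x) is Some p then - << p >>
  else 0.

Lemma theta_bracket x : theta (bracket x) = x.
Proof.
rewrite /bracket; case: insubP => [p _ <-|]; first by rewrite thetaU rmorph1 mul1r.
rewrite -leNgt => x_le0.
case: insubP => [p _ px|]; first by rewrite raddfN /= thetaU rmorph1 mul1r px opprK.
rewrite -leNgt oppr_le0 raddf0 => x_ge0.
by apply/eqP; rewrite eq_le x_ge0 x_le0.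
Qed.

Definition ker_theta : {pred WQ} := [pred w | theta w == 0].

Lemma ker_theta_zmod_closed : zmod_closed ker_theta.
Proof.
split=> [|u v]; rewrite !inE ?raddf0 // raddfB /= => /eqP-> /eqP->.
by rewrite subrr.
Qed.

Lemma ker_theta_proper : 1 \notin ker_theta /\
  forall a, {in ker_theta, forall u, a * u \in ker_theta}.
Proof.
split=> [|a u]; rewrite !inE ?rmorph1 ?oner_eq0 // rmorphM /= => /eqP->.
by rewrite mulr0.
Qed.

HB.instance Definition _ :=
  GRing.isZmodClosed.Build WQ ker_theta ker_theta_zmod_closed.
HB.instance Definition _ := isProperIdeal.Build WQ ker_theta ker_theta_proper.

Record Ker := MkKer { ker_val : WQ; _ : ker_val \in ker_theta }.

HB.instance Definition _ := [isSub for ker_val].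
HB.instance Definition _ := [Choice of Ker by <:].
HB.instance Definition _ := [SubChoice_isSubZmodule of Ker by <:].

Definition ker_act (w : WQ) (k : Ker) : Ker :=
  MkKer (idealMr w (valP k)).

Lemma ker_val_inj : injective ker_val. Proof. exact: val_inj. Qed.

Lemma ker_val_act w k : ker_val (ker_act w k) = w * ker_val k.
Proof. by []. Qed.

Lemma ker_valD : {morph ker_val : k l / k + l}.
Proof. exact: (raddfD val). Qed.

Lemma ker_valB : {morph ker_val : k l / k - l}.
Proof. exact: (raddfB val). Qed.

(* the ideal Ker(theta)^2, i.e. the finite sums of products of two elements *)
Definition sqr_ker_theta : {pred WQ} :=
  [pred w | `[< exists s : seq (Ker * Ker),
                  w = \sum_(p <- s) val p.1 * val p.2 >]].

Definition sqr_ker : {pred Ker} := [pred k : Ker | val k \in sqr_ker_theta].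

Lemma sqr_ker_zmod_closed : zmod_closed sqr_ker.
Proof.
split=> [|u v]; first by apply/asboolP; exists [::]; rewrite big_nil.
move=> /asboolP[s us] /asboolP[t vt]; apply/asboolP.
exists (s ++ [seq (- p.1, p.2) | p <- t]).
rewrite raddfB [X in X - _]us [X in _ - X]vt big_cat big_map -sumrN; congr (_ + _).
by apply: eq_bigr => p _; rewrite raddfN /= mulNr.
Qed.

HB.instance Definition _ :=
  GRing.isZmodClosed.Build Ker sqr_ker sqr_ker_zmod_closed.

Lemma sqr_ker_mul (k l : Ker) : ker_act (val k) l \in sqr_ker.
Proof. by apply/asboolP; exists [:: (k, l)]; rewrite big_seq1. Qed.

Lemma sqr_ker_act w (k : Ker) : k \in sqr_ker -> ker_act w k \in sqr_ker.
Proof.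
move=> /asboolP[s ks]; apply/asboolP; exists [seq (ker_act w p.1, p.2) | p <- s].
by rewrite big_map /= ks mulr_sumr; apply: eq_bigr => p _; rewrite mulrA.
Qed.

Definition Ker_mod_sq : Type := {ideal_quot sqr_ker}.
HB.instance Definition _ := GRing.Zmodule.on Ker_mod_sq.

Definition ker_class (k : Ker) : Ker_mod_sq := \pi_{ideal_quot sqr_ker} k.

Lemma ker_class_is_additive : zmod_morphism ker_class.
Proof. exact: (raddfB \pi_{ideal_quot sqr_ker}). Qed.

HB.instance Definition _ :=
  GRing.isZmodMorphism.Build Ker Ker_mod_sq ker_class ker_class_is_additive.

Lemma ker_class_eq k l : (ker_class k == ker_class l) = (k - l \in sqr_ker).
Proof. by rewrite Quotient.idealrBE. Qed.

Lemma ker_class_repr (c : Ker_mod_sq) :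
  ker_class (repr (c : {ideal_quot sqr_ker})) = c.
Proof. exact: reprK. Qed.

(* A real r acts as any element of W_Q that theta maps to r; the one chosen
   here is [r], and scale_theta below shows that the choice is irrelevant. *)
Definition ker_scale (r : R) (c : Ker_mod_sq) : Ker_mod_sq :=
  ker_class (ker_act (bracket r) (repr (c : {ideal_quot sqr_ker}))).

Lemma ker_scaleE r w k : theta w = r ->
  ker_scale r (ker_class k) = ker_class (ker_act w k).
Proof.
move=> wr; apply/eqP; rewrite ker_class_eq.
set k' := repr _.
have Ek : k' - k \in sqr_ker by rewrite -ker_class_eq ker_class_repr.
have Kd : bracket r - w \in ker_theta.
  by rewrite inE raddfB /= theta_bracket wr subrr.
have -> : ker_act (bracket r) k' - ker_act w k =
    ker_act (bracket r) (k' - k) + ker_act (val (MkKer Kd)) k.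
  apply: ker_val_inj; rewrite [RHS]ker_valD ker_valB !ker_val_act ker_valB.
  by rewrite mulrBr mulrBl addrA subrK.
by apply: rpredD; [exact: sqr_ker_act | exact: sqr_ker_mul].
Qed.

Lemma ker_scaleA a b c :
  ker_scale a (ker_scale b c) = ker_scale (a * b) c.
Proof.
rewrite -[c]ker_class_repr (ker_scaleE _ (theta_bracket b)).
rewrite (ker_scaleE _ (theta_bracket a)).
rewrite (@ker_scaleE _ (bracket a * bracket b)); last first.
  by rewrite rmorphM /= !theta_bracket.
by congr ker_class; apply: ker_val_inj; rewrite ?ker_valD !ker_val_act ?ker_valD mulrA.
Qed.

Lemma ker_scale1 : left_id 1 ker_scale.
Proof.
move=> c; rewrite -[c]ker_class_repr (ker_scaleE _ (rmorph1 theta)).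
by congr ker_class; apply: ker_val_inj; rewrite ?ker_valD !ker_val_act ?ker_valD mul1r.
Qed.

Lemma ker_scaleDr : right_distributive ker_scale +%R.
Proof.
move=> a c d; rewrite -[c]ker_class_repr -[d]ker_class_repr -raddfD.
rewrite !(ker_scaleE _ (theta_bracket a)) -raddfD.
by congr ker_class; apply: ker_val_inj; rewrite ?ker_valD !ker_val_act ?ker_valD mulrDr.
Qed.

Lemma ker_scaleDl c : {morph ker_scale^~ c : a b / a + b}.
Proof.
move=> a b; rewrite -[c]ker_class_repr (ker_scaleE _ (theta_bracket a)).
rewrite (ker_scaleE _ (theta_bracket b)) (@ker_scaleE _ (bracket a + bracket b)); last first.
  by rewrite raddfD /= !theta_bracket.
by rewrite -raddfD; congr ker_class; apply: ker_val_inj; rewrite ?ker_valD !ker_val_act mulrDl.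
Qed.

HB.instance Definition _ := GRing.Zmodule_isLmodule.Build R Ker_mod_sq
  ker_scaleA ker_scale1 ker_scaleDr ker_scaleDl.

Lemma scale_theta (w : WQ) (k : Ker) :
  theta w *: ker_class k = ker_class (ker_act w k).
Proof. exact: ker_scaleE. Qed.

Definition s_elt (x : R) : WQ := 1 - bracket x - bracket (1 - x).

Lemma s_in_ker x : s_elt x \in ker_theta.
Proof.
rewrite inE !raddfB /= rmorph1 !theta_bracket.
by rewrite opprB addrC subrKA subrr.
Qed.

Definition s_class (x : R) : Ker_mod_sq := ker_class (MkKer (s_in_ker x)).

End Theta.

Section QuotientModule.
Variables (R : nzRingType) (V : lmodType R).

Definition submod_gen (P : V -> Prop) : {pred V} :=
  [pred v | `[< exists t : seq (R * V),
                  (forall p, p \in t -> P p.2) /\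
                  v = \sum_(p <- t) p.1 *: p.2 >]].

Lemma submod_gen_closed (P : V -> Prop) : submod_closed (submod_gen P).
Proof.
split=> [|a u v]; first by apply/asboolP; exists [::]; rewrite big_nil.
move=> /asboolP[t [Pt ->]] /asboolP[t' [Pt' ->]]; apply/asboolP.
exists ([seq (a * p.1, p.2) | p <- t] ++ t'); split.
  move=> p; rewrite mem_cat => /orP[/mapP[q qt ->]|]; last exact: Pt'.
  exact: Pt qt.
rewrite big_cat big_map /= scaler_sumr; congr (_ + _).
by apply: eq_bigr => p _; rewrite scalerA.
Qed.

HB.instance Definition _ P :=
  GRing.isSubmodClosed.Build R V (submod_gen P) (submod_gen_closed P).

Variable P : V -> Prop.

Definition lmod_quot : Type := {ideal_quot (submod_gen P)}.
HB.instance Definition _ := GRing.Zmodule.on lmod_quot.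

Definition lmod_class (v : V) : lmod_quot := \pi_{ideal_quot (submod_gen P)} v.

Lemma lmod_class_is_additive : zmod_morphism lmod_class.
Proof. exact: (raddfB \pi_{ideal_quot (submod_gen P)}). Qed.

HB.instance Definition _ :=
  GRing.isZmodMorphism.Build V lmod_quot lmod_class lmod_class_is_additive.

Lemma lmod_class_repr (c : lmod_quot) :
  lmod_class (repr (c : {ideal_quot (submod_gen P)})) = c.
Proof. exact: reprK. Qed.

Definition lmod_quot_scale (a : R) (c : lmod_quot) : lmod_quot :=
  lmod_class (a *: repr (c : {ideal_quot (submod_gen P)})).

Lemma lmod_quot_scaleE a v :
  lmod_quot_scale a (lmod_class v) = lmod_class (a *: v).
Proof.
apply/eqP; rewrite -[_ == _]Quotient.idealrBE -scalerBr rpredZ //.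
by rewrite Quotient.idealrBE; apply/eqP; exact: lmod_class_repr.
Qed.

Lemma lmod_quot_scaleA a b c :
  lmod_quot_scale a (lmod_quot_scale b c) = lmod_quot_scale (a * b) c.
Proof. by rewrite -[c]lmod_class_repr !lmod_quot_scaleE scalerA. Qed.

Lemma lmod_quot_scale1 : left_id 1 lmod_quot_scale.
Proof. by move=> c; rewrite -[c]lmod_class_repr lmod_quot_scaleE scale1r. Qed.

Lemma lmod_quot_scaleDr : right_distributive lmod_quot_scale +%R.
Proof.
move=> a c d; rewrite -[c]lmod_class_repr -[d]lmod_class_repr -raddfD.
by rewrite !lmod_quot_scaleE -raddfD scalerDr.
Qed.

Lemma lmod_quot_scaleDl c : {morph lmod_quot_scale^~ c : a b / a + b}.
Proof.
move=> a b; rewrite -[c]lmod_class_repr !lmod_quot_scaleE -raddfD.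
by rewrite scalerDl.
Qed.

HB.instance Definition _ := GRing.Zmodule_isLmodule.Build R lmod_quot
  lmod_quot_scaleA lmod_quot_scale1 lmod_quot_scaleDr lmod_quot_scaleDl.

Lemma lmod_class_is_scalable : scalable lmod_class.
Proof. by move=> a v; rewrite -lmod_quot_scaleE. Qed.

HB.instance Definition _ := GRing.isScalable.Build R V lmod_quot *:%R
  lmod_class lmod_class_is_scalable.

End QuotientModule.

Section Omega.
Variable R : realType.

(* the basis vector attached to x in the free R-vector space on the set R *)
Definition symb (x : R) : {malg R[R]} := << 1 *g x >>.

(* each relation is listed as the difference of its two sides *)
Inductive omega_rel : {malg R[R]} -> Prop :=
| OmegaA (x : R) : omega_rel (symb (1 - x) - symb x)
| OmegaB (x y : R) : y != 0 -> y != 1 ->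
    omega_rel (symb (x + y)
               - (symb y + (1 - y) *: symb (x / (1 - y))
                  + y *: symb (- (x / y))))
| OmegaC (x : R) : x != 0 -> omega_rel (x *: symb (1 / x) - (- symb x)).

Definition Omega : Type := lmod_quot omega_rel.
HB.instance Definition _ := GRing.Lmodule.on Omega.

Definition eps (x : R) : Omega := lmod_class omega_rel (symb x).

End Omega.

(* Vector.axiom n V is the type of linear bijections from V to 'rV[R]_n *)
Definition infinite_dimensional (R : nzRingType) (V : lmodType R) : Prop :=
  forall n : nat, Vector.axiom n V -> False.

(* Main.v *)
From HB Require Import structures.
Require Import Defs.
From mathcomp Require Import all_boot all_order all_algebra.
From mathcomp Require Import reals.
From mathcomp Require Import generic_quotient ring_quotient finmap monalg.
From mathcomp Require Import boolp classical_sets exp ring lra.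

(** The relations (A), (B), (C) are exactly what makes addition associative in a
    square-zero extension of R that has a multiplicative section.

    Modulo Ker(theta)^2, the ring W_Q is an extension of R by the R-module
    M = Ker(theta)/Ker(theta)^2, and x |-> [x] is a multiplicative section of
    it, odd once extended to all of R.  As a set the extension is R x M, a pair
    (r, m) standing for [r] + m.  Multiplication is then forced, and addition is
    given by a symmetric cocycle c with [x] + [y] = [x + y] + c(x, y).  Since the
    section is multiplicative, c is homogeneous, so it is determined by its
    values on the line x + y = 1, where c(x, 1 - x) = - s(x):
        c(x, y) = - (x + y) s(x / (x + y)).
    Commutativity of addition is (A), and associativity on x + y + z = 1 is (B)
    after one term has been inverted by (C).  Hence s satisfies the relations
    ([s_class_symbol]), which gives a linear map Omega -> M.

    Conversely, let e : R -> V satisfy the relations.  The same formulas with e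
    in place of s define a commutative ring E on R x V ([cocycleA] is the main
    point).  Nonzero integers are invertible in E, so x |-> (x, 0) extends to a
    ring morphism W_Q -> E above theta.  It maps Ker(theta) to the square-zero
    ideal V, hence kills Ker(theta)^2, and it maps s(x) to e(x).  For V = Omega
    this is a linear map M -> Omega ([class_lift]) sending s(x) to eps(x).  The
    two maps are mutually inverse because both sides are spanned by the symbols;
    for M this holds because, modulo the ideal generated by the s(x), the map [.]
    becomes additive, so that every w is congruent to [theta w]
    ([ker_theta_generated]).

    For the dimension, a homomorphism chi from the additive group of R to itself
    makes D(x) = x chi(ln |x|) satisfy D(x y) = x D(y) + y D(x), and the failure
    of additivity e(x) = - (D(x) + D(1 - x)) then satisfies the relations.  For
    each prime p, extend the p-adic valuation to a Q-linear functional chi on R,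
    identified with the positive reals by the logarithm ([padic_log], by Zorn's
    lemma).  The resulting functional on Omega is nonzero at eps(p) and vanishes
    at eps(q) for integers 1 < q < p, since p divides neither q nor q - 1.  Such
    a triangular family over all primes excludes a finite dimension
    ([triangular_infinite_dimensional]). *)

Set Implicit Arguments.
Unset Strict Implicit.
Unset Printing Implicit Defensive.

Import Order.TTheory GRing.Theory Num.Theory.
Local Open Scope ring_scope.

(** * The symmetric cocycle attached to a symbol *)

Definition omega_symbol (F : fieldType) (V : lmodType F) (e : F -> V) : Prop :=
  [/\ forall x, e (1 - x) = e x,
      forall x y, y != 0 -> y != 1 ->
        e (x + y) = e y + (1 - y) *: e (x / (1 - y)) + y *: e (- (x / y))
    & forall x, x != 0 -> x *: e (1 / x) = - e x].

Section Cocycle.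
Variables (F : numFieldType) (V : lmodType F) (e : F -> V).

Definition cocycle (x y : F) : V := - ((x + y) *: e (x / (x + y))).

Lemma cocycleZ a x y : cocycle (a * x) (a * y) = a *: cocycle x y.
Proof.
rewrite /cocycle -mulrDr scalerN scalerA.
have [->|a0] := eqVneq a 0; first by rewrite !mul0r !scale0r.
by rewrite invfM mulrACA divff // mul1r.
Qed.

Lemma cocycle_oppr x : cocycle x (- x) = 0.
Proof. by rewrite /cocycle subrr scale0r oppr0. Qed.

Hypothesis he : omega_symbol e.

(** (B) at x = 0 leaves ((1 - y) + y) e(0) = 0. *)
Lemma omega_symbol0 : e 0 = 0.
Proof.
have N0 : -1 != 0 :> F by rewrite oppr_eq0 oner_eq0.
have N1 : -1 != 1 :> F by rewrite lt_eqF // (lt_trans (ltrN10 _)) ?ltr01.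
case: he => _ /(_ 0 _ N0 N1) + _.
rewrite !mul0r oppr0 add0r -addrA -scalerDl subrK scale1r => /esym/eqP.
by rewrite -subr_eq0 addrAC subrr add0r => /eqP.
Qed.

Lemma omega_symbol1 : e 1 = 0.
Proof. by case: he => hA _ _; rewrite -[1]subr0 hA omega_symbol0. Qed.

Lemma cocycleC x y : cocycle x y = cocycle y x.
Proof.
case: he => hA _ _; rewrite /cocycle addrC.
have [->|yx0] := eqVneq (y + x) 0; first by rewrite !scale0r.
by rewrite -[in RHS]hA -[in RHS](divff yx0) -mulrBl [y + x]addrC addrK.
Qed.

Lemma cocycle0l y : cocycle 0 y = 0.
Proof. by rewrite /cocycle mul0r omega_symbol0 scaler0 oppr0. Qed.

(** (C) trades the asymmetric ratio x / (x + y) for 1 + y / x, and (A) turns the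
    latter into - (y / x), the form in which (B) contains it. *)
Lemma cocycle_ratio x y : x != 0 -> cocycle x y = x *: e (- (y / x)).
Proof.
move=> x0; rewrite /cocycle.
have [xy0|xy0] := eqVneq (x + y) 0.
  rewrite xy0 scale0r (_ : y = - x); last first.
    by apply/eqP; rewrite -addr_eq0 addrC xy0.
  by rewrite mulNr opprK divff // omega_symbol1 scaler0 oppr0.
case: he => hA _ hC.
have /hC : x / (x + y) != 0 by rewrite mulf_neq0 ?invr_eq0.
have -> : e (- (y / x)) = e (1 / (x / (x + y))).
  by rewrite -hA opprK div1r invf_div mulrDl divff.
by move=> h; rewrite -scalerN -h scalerA mulrCA divff // mulr1.
Qed.

(** The cocycle identity in its normalized form: for x different from 0 and 1 it
    is (B), and the excluded values of x hold because e(0) = e(1) = 0. *)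
Lemma cocycle_sum1 x y z : x + y + z = 1 ->
  cocycle x y + cocycle (x + y) z = cocycle y z + cocycle x (y + z).
Proof.
move=> xyz1; have -> : cocycle (x + y) z = - e (x + y).
  by rewrite /cocycle xyz1 divr1 scale1r.
have -> : cocycle x (y + z) = - e x.
  by rewrite /cocycle addrA xyz1 divr1 scale1r.
have yz : y + z = 1 - x by rewrite -xyz1; ring.
rewrite [cocycle y z]/cocycle yz.
have [x0|x0] := eqVneq x 0.
  by rewrite x0 cocycle0l !add0r subr0 divr1 scale1r omega_symbol0 oppr0 addr0.
have [x1|x1] := eqVneq x 1.
  rewrite x1 subrr scale0r oppr0 add0r omega_symbol1 oppr0.
  rewrite cocycle_ratio ?oner_neq0 //.
  case: he => hA _ _; rewrite scale1r divr1 -[e (1 + y)]hA opprD addNKr.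
  by rewrite subrr.
case: he => _ hB _; rewrite cocycle_ratio // [x + y]addrC hB //.
by rewrite opprD addrC subrK opprD addrC.
Qed.

(** Homogeneity reduces to x + y + z = 1, except when the sum is 0; there both
    sides reduce to the single term rewritten by [cocycle_ratio]. *)
Lemma cocycleA x y z :
  cocycle x y + cocycle (x + y) z = cocycle y z + cocycle x (y + z).
Proof.
have [s0|s0] := eqVneq (x + y + z) 0.
  have -> : z = - (x + y) by apply/eqP; rewrite -addr_eq0 addrC s0.
  rewrite cocycle_oppr addr0 opprD addrCA subrr addr0 cocycle_oppr addr0.
  have [->|x0] := eqVneq x 0.
    by rewrite oppr0 add0r cocycle0l cocycle_oppr.
  rewrite cocycle_ratio // /cocycle addrCA subrr addr0 scaleNr opprK.
  by rewrite invrN mulrN.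
have := s0; set s := x + y + z => s'0.
have /cocycle_sum1/(congr1 ( *:%R s)) : s^-1 * x + s^-1 * y + s^-1 * z = 1.
  by rewrite -!mulrDr mulVf.
by rewrite !scalerDr -!cocycleZ !mulrDr !mulVKf.
Qed.

End Cocycle.

(** * The square-zero extension attached to a symbol *)

Section Thickening.
Variables (F : numFieldType) (V : lmodType F) (e : F -> V).

(** A pair (r, m) stands for tau(r) + m, where tau is the multiplicative section.
    The proof that e satisfies the relations is a parameter of the type, so that
    the ring structure can be inferred from the type alone. *)
Definition thickening (he : omega_symbol e) : Type := (F * V)%type.

Variable he : omega_symbol e.
Local Notation E := (thickening he).

HB.instance Definition _ := Choice.on E.

Definition thick_zero : E := (0, 0).
Definition thick_one : E := (1, 0).
Definition thick_opp (u : E) : E := (- u.1, - u.2).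
Definition thick_add (u v : E) : E :=
  (u.1 + v.1, u.2 + v.2 + cocycle e u.1 v.1).
Definition thick_mul (u v : E) : E := (u.1 * v.1, u.1 *: v.2 + v.1 *: u.2).
Definition thick_unit : {pred E} := [pred u | u.1 != 0].
(** (r + m)^-1 = r^-1 - r^-2 m as m^2 = 0.  An element with r = 0 is not a unit,
    and the inverse of a non-unit is itself by convention. *)
Definition thick_inv (u : E) : E :=
  if u.1 == 0 then u else (u.1^-1, - (u.1 ^- 2 *: u.2)).

Lemma thick_addA : associative thick_add.
Proof.
move=> [a u] [b v] [c w]; rewrite /thick_add /= addrA; congr pair.
rewrite !addrA [u + v + _ + w]addrAC -[LHS]addrA -[RHS]addrA.
by rewrite (cocycleA he).
Qed.

Lemma thick_addC : commutative thick_add.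
Proof.
move=> [a u] [b v].
by rewrite /thick_add /= (cocycleC he) [a + b]addrC [u + v]addrC.
Qed.

Lemma thick_add0 : left_id thick_zero thick_add.
Proof. by move=> [a u]; rewrite /thick_add /= !add0r (cocycle0l he) addr0. Qed.

Lemma thick_addN : left_inverse thick_zero thick_opp thick_add.
Proof.
by move=> [a u]; rewrite /thick_add /= !addNr -{2}[a]opprK cocycle_oppr addr0.
Qed.

HB.instance Definition _ := GRing.isZmodule.Build E
  thick_addA thick_addC thick_add0 thick_addN.

Lemma thick_mulA : associative thick_mul.
Proof.
move=> [a u] [b v] [c w]; rewrite /thick_mul /= mulrA; congr pair.
by rewrite !scalerDr !scalerA addrA [c * a]mulrC [c * b]mulrC.
Qed.

Lemma thick_mulC : commutative thick_mul.
Proof. by move=> [a u] [b v]; rewrite /thick_mul /= mulrC addrC. Qed.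

Lemma thick_mul1 : left_id thick_one thick_mul.
Proof. by move=> [a u]; rewrite /thick_mul /= mul1r scale1r scaler0 addr0. Qed.

Lemma thick_mulDl : left_distributive thick_mul thick_add.
Proof.
move=> [a u] [b v] [c w]; rewrite /thick_mul /thick_add /= mulrDl; congr pair.
by rewrite ![_ * c]mulrC cocycleZ scalerDl !scalerDr addrA addrACA.
Qed.

Lemma thick_one_neq0 : thick_one != 0 :> E.
Proof. by apply/eqP => -[/eqP]; rewrite oner_eq0. Qed.

HB.instance Definition _ := GRing.Zmodule_isComNzRing.Build E
  thick_mulA thick_mulC thick_mul1 thick_mulDl thick_one_neq0.

Lemma thick_mulVl : {in thick_unit, left_inverse 1 thick_inv *%R}.
Proof.
move=> [a u]; rewrite inE /= => a0.
rewrite /thick_inv /= (negPf a0); apply: injective_projections => /=.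
  by rewrite mulVf.
rewrite scalerN scalerA.
have -> : a * a ^- 2 = a^-1 by field.
by rewrite subrr.
Qed.

Lemma thick_unitPl (u v : E) : v * u = 1 -> u \in thick_unit.
Proof.
move=> /(congr1 fst) /= vu1; rewrite inE; apply: contra_eq_neq vu1 => ->.
by rewrite mulr0 eq_sym oner_eq0.
Qed.

Lemma thick_inv_out : {in [predC thick_unit], thick_inv =1 id}.
Proof. by move=> u; rewrite !inE negbK /thick_inv => ->. Qed.

HB.instance Definition _ := GRing.ComNzRing_hasMulInverse.Build E
  thick_mulVl thick_unitPl thick_inv_out.

Definition thick_proj (u : E) : F := u.1.

Lemma thick_proj_is_additive : zmod_morphism thick_proj.
Proof. by []. Qed.

Lemma thick_proj_is_multiplicative : monoid_morphism thick_proj.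
Proof. by []. Qed.

HB.instance Definition _ :=
  GRing.isZmodMorphism.Build E F thick_proj thick_proj_is_additive.
HB.instance Definition _ :=
  GRing.isMonoidMorphism.Build E F thick_proj thick_proj_is_multiplicative.

Lemma thick_unit_nat n : (n.+1%:R : E) \is a GRing.unit.
Proof.
rewrite /GRing.unit inE /=.
by rewrite -[_.1]/(thick_proj _) rmorph_nat pnatr_eq0.
Qed.

(** The multiplicative (Teichmueller) section of the projection to F. *)
Definition teich (x : F) : E := (x, 0).

Lemma teichM : {morph teich : x y / x * y}.
Proof.
move=> x y; apply: injective_projections => //=.
by rewrite !scaler0 addr0.
Qed.

Lemma teichN : {morph teich : x / - x}.
Proof. by move=> x; apply: injective_projections => //=; rewrite oppr0. Qed.

(** The extension realizes e as the defect of additivity of its section, as s is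
    for the section x |-> [x] of W_Q / Ker(theta)^2. *)
Lemma teich_symbol x : (1 - teich x - teich (1 - x) : E) = (0, e x).
Proof.
rewrite -addrA -opprD; apply/eqP; rewrite subr_eq; apply/eqP.
apply: injective_projections => /=; rewrite [x + _]addrC subrK ?add0r //.
by rewrite (cocycle0l he) addr0 /cocycle [x + _]addrC subrK scale1r divr1 subrr.
Qed.

End Thickening.

(** * Rational scalars in a ring where nonzero integers are invertible *)

Section RationalScalars.
Variable A : comUnitRingType.
Hypothesis unit_nat : forall n, (n.+1%:R : A) \is a GRing.unit.

Lemma int_unit (b : int) : b != 0 -> (b%:~R : A) \is a GRing.unit.
Proof.
by case: b => [[|n]|n] // _; rewrite ?NegzE ?rmorphN ?unitrN; exact: unit_nat.
Qed.

(** The value of [ratr] may be computed on any fraction, reduced or not: this is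
    what makes it compatible with sums and products. *)
Lemma ratr_frac (a b : int) : b != 0 -> ratr (a%:Q / b%:Q) = a%:~R / b%:~R :> A.
Proof.
move=> b0; set q := _ / _.
have d0 := denq_neq0 q; apply: (canRL (mulrK (int_unit b0))).
rewrite /ratr mulrAC; apply: (canLR (mulrK (int_unit d0))).
rewrite -!rmorphM; congr (_%:~R); apply: (@intr_inj rat).
rewrite !rmorphM /= numqE; rewrite mulrAC divfK //.
by rewrite intr_eq0.
Qed.

Lemma ratr_zmod_morphism : zmod_morphism (@ratr A).
Proof.
move=> x y; have dx := denq_neq0 x; have dy := denq_neq0 y.
have -> : x - y =
    (numq x * denq y - numq y * denq x)%:Q / (denq x * denq y)%:Q.
  rewrite -[in LHS](divq_num_den x) -[in LHS](divq_num_den y).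
  by rewrite !rmorphB !rmorphM /=; field; rewrite !intr_eq0 dx dy.
rewrite ratr_frac ?mulf_neq0 // /ratr rmorphB !rmorphM /=.
rewrite mulrBl invrM ?int_unit // mulrA mulrK ?int_unit //.
by rewrite [_^-1 * _^-1]mulrC mulrA mulrK ?int_unit.
Qed.

Lemma ratr_monoid_morphism : monoid_morphism (@ratr A).
Proof.
split=> [|x y]; first exact: (ratr_nat A 1).
have dx := denq_neq0 x; have dy := denq_neq0 y.
have -> : x * y = (numq x * numq y)%:Q / (denq x * denq y)%:Q.
  rewrite -[in LHS](divq_num_den x) -[in LHS](divq_num_den y).
  by rewrite !rmorphM /=; field; rewrite !intr_eq0 dx dy.
rewrite ratr_frac ?mulf_neq0 // /ratr !rmorphM /= invrM ?int_unit //.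
by rewrite [RHS]mulrACA [_^-1 * _^-1 in RHS]mulrC.
Qed.

Lemma rmorph_ratr (B : unitRingType) (f : {rmorphism A -> B}) q :
  f (ratr q) = ratr q.
Proof.
rewrite /ratr (rmorphM f) (rmorph_int f).
by rewrite (rmorphV f) ?int_unit ?denq_neq0 // (rmorph_int f).
Qed.

End RationalScalars.

(** * Morphisms from the rational group ring of the positive reals *)

Section GroupRingLift.
Variables (R : realType) (A : comUnitRingType).
Hypothesis unit_nat : forall n, (n.+1%:R : A) \is a GRing.unit.
Variable t : posR R -> A.
Hypothesis t1 : t 1%g = 1.
Hypothesis tM : forall x y, t (x * y)%g = t x * t y.

Let lift_term (g : posR R) (a : rat) : A := ratr a * t g.

Let lift_term_additive g : zmod_morphism (lift_term g).
Proof.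
by move=> a b; rewrite /lift_term (ratr_zmod_morphism unit_nat) mulrBl.
Qed.

HB.instance Definition _ g :=
  GRing.isZmodMorphism.Build rat A (lift_term g) (lift_term_additive g).

Definition WQ_lift (w : WQ R) : A := \sum_(g <- msupp w) ratr w@_g * t g.

Lemma WQ_lift_zmod_morphism : zmod_morphism WQ_lift.
Proof. by move=> u v; exact: (msum_is_additive (fun g => lift_term g) u v). Qed.

HB.instance Definition _ :=
  GRing.isZmodMorphism.Build (WQ R) A WQ_lift WQ_lift_zmod_morphism.

Lemma WQ_liftU c g : WQ_lift << c *g g >> = ratr c * t g.
Proof. exact: (msumU (fun g => lift_term g)). Qed.

Lemma WQ_lift_monoid_morphism : monoid_morphism WQ_lift.
Proof.
have [r1 rM] := ratr_monoid_morphism unit_nat.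
split=> [|x y]; first by rewrite [1]/(ga_one _ _) WQ_liftU r1 mul1r.
rewrite [x]monalgE [y]monalgE [X in WQ_lift X]ga_mul_suml !raddf_sum mulr_suml.
apply: eq_bigr => i _; rewrite ga_mul_sumr raddf_sum mulr_sumr.
apply: eq_bigr => j _; rewrite ga_mulUU.
by rewrite /= !WQ_liftU rM tM mulrACA.
Qed.

HB.instance Definition _ :=
  GRing.isMonoidMorphism.Build (WQ R) A WQ_lift WQ_lift_monoid_morphism.

End GroupRingLift.

(** * The relations between the elements s(x) *)

Section Bracket.
Variable R : realType.
Implicit Types x y : R.

Lemma bracket_val (p : posR R) : bracket (val p) = << p >>.
Proof. by rewrite /bracket valK. Qed.

Lemma bracket0 : bracket (0 : R) = 0.
Proof. by rewrite /bracket oppr0; case: insubP => //= p; rewrite ltxx. Qed.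

Lemma bracketN x : bracket (- x) = - bracket x.
Proof.
rewrite /bracket opprK; case: insubP => [p pN|xN].
  by rewrite insubN ?opprK // -leNgt ltW // -oppr_gt0.
by case: insubP => [p _ _|]; rewrite ?oppr0.
Qed.

(** The oddness of the extension to R reduces this to positive x and y. *)
Lemma bracketM : {morph @bracket R : x y / x * y}.
Proof.
have pos x y : 0 < x -> 0 < y -> bracket (x * y) = bracket x * bracket y.
  move=> x0 y0; pose p := PosR x0; pose q := PosR y0.
  rewrite (bracket_val p) (bracket_val q) (bracket_val (p * q)%g).
  by rewrite [RHS]ga_mulUU mulr1.
have posl x y : 0 < x -> bracket (x * y) = bracket x * bracket y.
  move=> x0; have [y0|y0|<-] := ltgtP 0 y; first exact: pos.
    by rewrite -[y]opprK mulrN 2!bracketN [RHS]mulrN pos ?oppr_gt0.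
  by rewrite mulr0 !bracket0 mulr0.
move=> x y; have [x0|x0|<-] := ltgtP 0 x; first exact: posl.
  by rewrite -[x]opprK mulNr 2!bracketN [RHS]mulNr posl ?oppr_gt0.
by rewrite mul0r !bracket0 mul0r.
Qed.

Lemma bracket1 : bracket (1 : R) = 1.
Proof. by rewrite -[1]/(val (1%g : posR R)) bracket_val. Qed.

(** The elements s(x) satisfy (A), (B), (C) already in W_Q, if a real scalar r
    acts as multiplication by [r]: only the multiplicativity and the oddness of
    the bracket are involved. *)
Lemma bracket_symbolA x : s_elt (1 - x) = s_elt x.
Proof. by rewrite /s_elt subKr addrAC. Qed.

Lemma bracket_symbolB x y : y != 0 -> y != 1 ->
  s_elt (x + y) = s_elt y + bracket (1 - y) * s_elt (x / (1 - y))
                  + bracket y * s_elt (- (x / y)).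
Proof.
move=> y0 y1; rewrite /s_elt !mulrBr !mulr1 -!bracketM.
have y1' : 1 - y != 0 by rewrite subr_eq0 eq_sym.
have -> : (1 - y) * (x / (1 - y)) = x by field.
have -> : (1 - y) * (1 - x / (1 - y)) = 1 - (x + y) by field.
have -> : y * (- (x / y)) = - x by field.
have -> : y * (1 - - (x / y)) = x + y by field.
have ringid (A : comNzRingType) (a b c d f : A) :
  1 - a - b = 1 - d - f + (f - c - b) + (d - - c - a) by ring.
by rewrite bracketN; exact: ringid.
Qed.

Lemma bracket_symbolC x : x != 0 -> bracket x * s_elt (1 / x) = - s_elt x.
Proof.
move=> x0; rewrite /s_elt !mulrBr !mulr1 -!bracketM.
have -> : x * (1 / x) = 1 by field.
have -> : x * (1 - 1 / x) = - (1 - x) by field.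
by rewrite bracketN bracket1 opprK !opprD !opprK [X in X + _]addrC.
Qed.

End Bracket.

Lemma scale_s_class (R : realType) (a x : R) :
  a *: s_class x = ker_class (ker_act (bracket a) (MkKer (s_in_ker x))).
Proof. by rewrite -{1}[a]theta_bracket scale_theta. Qed.

Lemma s_class_symbol (R : realType) : omega_symbol (@s_class R).
Proof.
split=> [x|x y y0 y1|x x0].
- by congr ker_class; apply: ker_val_inj; exact: bracket_symbolA.
- rewrite !scale_s_class -2!(raddfD (@ker_class R)).
  congr ker_class; apply: ker_val_inj.
  by rewrite !ker_valD !ker_val_act; exact: bracket_symbolB.
- rewrite scale_s_class -(raddfN (@ker_class R)).
  congr ker_class; apply: ker_val_inj.
  by rewrite ker_val_act bracket_symbolC // (raddfN val).
Qed.

(** * Universal property of Ker(theta)/Ker(theta)^2 *)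

Section KerLift.
Variables (R : realType) (V : lmodType R) (e : R -> V).
Hypothesis he : omega_symbol e.
Local Notation E := (thickening he).

Definition thick_lift : WQ R -> E :=
  WQ_lift (fun p : posR R => teich he (val p)).

Let teich_pos1 : teich he (val (1%g : posR R)) = 1. Proof. by []. Qed.

Let teich_posM (p q : posR R) :
  teich he (val (p * q)%g) = teich he (val p) * teich he (val q).
Proof. exact: teichM. Qed.

HB.instance Definition _ := GRing.isZmodMorphism.Build (WQ R) E thick_lift
  (WQ_lift_zmod_morphism (@thick_unit_nat _ _ _ he) _).
HB.instance Definition _ := GRing.isMonoidMorphism.Build (WQ R) E thick_lift
  (WQ_lift_monoid_morphism (@thick_unit_nat _ _ _ he) teich_pos1 teich_posM).

Lemma thick_lift_pos p : thick_lift << p >> = teich he (val p).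
Proof.
rewrite /thick_lift (WQ_liftU (@thick_unit_nat _ _ _ he)).
by rewrite (ratr_nat _ 1) mul1r.
Qed.

Lemma thick_lift_bracket x : thick_lift (bracket x) = teich he x.
Proof.
rewrite /bracket; case: insubP => [p _ <-|]; first exact: thick_lift_pos.
rewrite -leNgt => x_le0; case: insubP => [p _ px|].
  by rewrite raddfN /= thick_lift_pos px -teichN opprK.
rewrite -leNgt oppr_le0 raddf0 => x_ge0.
by rewrite -(@le_anti _ _ 0 x) ?x_ge0 // x_le0.
Qed.

Lemma thick_lift_proj w : thick_proj (thick_lift w) = theta w.
Proof.
rewrite /thick_lift /WQ_lift raddf_sum; apply: eq_bigr => g _.
rewrite -[LHS]/(thick_proj (ratr w@_g) * val g); congr (_ * _).
exact: (rmorph_ratr (@thick_unit_nat _ _ _ he) (@thick_proj _ _ _ he)).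
Qed.

Lemma thick_lift_symbol x : thick_lift (s_elt x) = (0, e x).
Proof.
rewrite /s_elt !raddfB /= rmorph1.
by rewrite !thick_lift_bracket teich_symbol.
Qed.

Definition ker_lift (k : Ker R) : V := (thick_lift (val k)).2.

(** The morphism lies above theta, so it maps Ker(theta) to the square-zero
    ideal V. *)
Lemma thick_lift_ker k : thick_lift (val k) = (0, ker_lift k).
Proof.
apply: injective_projections => //=.
by rewrite -[LHS]/(thick_proj _) thick_lift_proj; apply/eqP; case: k.
Qed.

Lemma ker_lift_zmod_morphism : zmod_morphism ker_lift.
Proof.
move=> k l; rewrite {1}/ker_lift.
have -> : thick_lift (val (k - l)) = thick_lift (val k) - thick_lift (val l).
  by rewrite -(raddfB thick_lift); congr thick_lift; exact: (raddfB val).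
rewrite !thick_lift_ker /=.
by rewrite oppr0 /cocycle addr0 scale0r subr0.
Qed.

HB.instance Definition _ :=
  GRing.isZmodMorphism.Build (Ker R) V ker_lift ker_lift_zmod_morphism.

Lemma ker_lift_act w k : ker_lift (ker_act w k) = theta w *: ker_lift k.
Proof.
rewrite {1}/ker_lift [val _]/(w * val k) rmorphM /= thick_lift_ker /=.
by rewrite scale0r addr0 -thick_lift_proj.
Qed.

Lemma ker_lift_sqr (k : Ker R) : k \in @sqr_ker R -> ker_lift k = 0.
Proof.
move=> /asboolP[s ks]; rewrite /ker_lift ks raddf_sum.
suff -> : \sum_(p <- s) thick_lift (val p.1 * val p.2) = 0 by [].
apply: big1 => p _; rewrite rmorphM /= !thick_lift_ker.
by apply: injective_projections => /=; rewrite ?mul0r ?scale0r ?addr0.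
Qed.

Definition class_lift (c : Ker_mod_sq R) : V :=
  ker_lift (repr (c : {ideal_quot (@sqr_ker R)})).

Lemma class_liftE k : class_lift (ker_class k) = ker_lift k.
Proof.
apply/eqP; rewrite -subr_eq0 -raddfB /=; apply/eqP/ker_lift_sqr.
by rewrite -ker_class_eq ker_class_repr.
Qed.

Lemma class_lift_zmod_morphism : zmod_morphism class_lift.
Proof.
move=> c d; rewrite -[c]ker_class_repr -[d]ker_class_repr -raddfB.
by rewrite !class_liftE raddfB.
Qed.

Lemma class_lift_scalable : scalable class_lift.
Proof.
move=> a c; rewrite -[c]ker_class_repr -[a]theta_bracket scale_theta.
by rewrite !class_liftE ker_lift_act.
Qed.

HB.instance Definition _ := GRing.isZmodMorphism.Build
  (Ker_mod_sq R) V class_lift class_lift_zmod_morphism.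
HB.instance Definition _ := GRing.isScalable.Build
  R (Ker_mod_sq R) V *:%R class_lift class_lift_scalable.

Lemma class_lift_symbol x : class_lift (s_class x) = e x.
Proof. by rewrite class_liftE /ker_lift thick_lift_symbol. Qed.

End KerLift.

(** * Ker(theta) is the ideal generated by the elements s(x) *)

Section KerGenerators.
Variable R : realType.

Definition s_ideal : {pred (WQ R)^o} :=
  submod_gen (fun v : (WQ R)^o => exists x, v = s_elt x).

Lemma s_ideal_gen x : s_elt x \in s_ideal.
Proof.
apply/asboolP; exists [:: (1, s_elt x)].
by split=> [p|]; rewrite ?big_seq1 ?scale1r // inE => /eqP ->; exists x.
Qed.

Lemma s_ideal0 : (0 : WQ R) \in s_ideal.
Proof. exact: (@rpred0 _ s_ideal). Qed.

Lemma s_idealM (a w : WQ R) : w \in s_ideal -> a * w \in s_ideal.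
Proof. exact: (@rpredZ _ _ s_ideal). Qed.

Lemma s_idealD (a b : WQ R) :
  a \in s_ideal -> b \in s_ideal -> a + b \in s_ideal.
Proof. exact: (@rpredD _ s_ideal). Qed.

Lemma s_idealN (a : WQ R) : a \in s_ideal -> - a \in s_ideal.
Proof. exact: (@rpredNr _ s_ideal). Qed.

(** The defect of additivity of the bracket is a multiple of s(x / (x + y)). *)
Lemma bracketD_mod (x y : R) :
  bracket x + bracket y - bracket (x + y) \in s_ideal.
Proof.
have [xy0|xy0] := eqVneq (x + y) 0.
  have -> : y = - x by apply/eqP; rewrite -addr_eq0 addrC xy0.
  by rewrite subrr bracket0 bracketN subrr subr0; exact: s_ideal0.
have -> : bracket x + bracket y - bracket (x + y) =
    - (bracket (x + y) * s_elt (x / (x + y))).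
  rewrite /s_elt !mulrBr mulr1 -!bracketM mulrBr mulr1 mulrCA divff // mulr1.
  by rewrite [x + y - x]addrAC subrr add0r !opprB addrA [bracket y + _]addrC.
by apply/s_idealN/s_idealM/s_ideal_gen.
Qed.

Local Notation approx w := (w - bracket (theta w) \in s_ideal).

Lemma bracket_approxD (v w : WQ R) : approx v -> approx w -> approx (v + w).
Proof.
move=> hv hw; rewrite raddfD /=.
have -> : v + w - bracket (theta v + theta w) =
    (v - bracket (theta v)) + (w - bracket (theta w))
    + (bracket (theta v) + bracket (theta w) - bracket (theta v + theta w)).
  by rewrite [v - _ + (w - _)]addrACA -opprD addrA subrK.
by apply: s_idealD (bracketD_mod _ _); exact: s_idealD.
Qed.

Lemma bracket_approxM (v w : WQ R) : approx v -> approx w -> approx (v * w).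
Proof.
move=> hv hw; rewrite rmorphM /= bracketM.
have -> : v * w - bracket (theta v) * bracket (theta w) =
    w * (v - bracket (theta v)) + bracket (theta v) * (w - bracket (theta w)).
  by rewrite !mulrBr [w * v]mulrC [w * _]mulrC addrA subrK.
by apply: s_idealD; exact: s_idealM.
Qed.

Lemma bracket_approxN (w : WQ R) : approx w -> approx (- w).
Proof. by move=> hw; rewrite raddfN /= bracketN -opprD; exact: s_idealN. Qed.

Lemma bracket_approx_pos (p : posR R) : approx << p >>.
Proof.
rewrite thetaU rmorph1 mul1r bracket_val subrr.
exact: s_ideal0.
Qed.

Lemma bracket_approx_nat n : approx n%:R.
Proof.
elim: n => [|n ih]; first by rewrite !raddf0 bracket0 subrr; exact: s_ideal0.
rewrite -natr1; apply: bracket_approxD => //.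
exact: (bracket_approx_pos 1%g).
Qed.

Definition WQ_const (q : rat) : WQ R := << q *g 1%g >>.

Lemma WQ_constM a b : WQ_const (a * b) = WQ_const a * WQ_const b.
Proof. by rewrite [RHS]ga_mulUU mulg1. Qed.

Lemma WQ_const_nat n : WQ_const n%:R = n%:R.
Proof.
elim: n => [|n ih]; first by rewrite /WQ_const monalgU0.
by rewrite -!natr1 -ih /WQ_const monalgUD.
Qed.

(** With u = 1 / (n + 1), the difference u - [u] is a multiple of
    1 - (n + 1) [u], which is a defect of additivity of the bracket. *)
Lemma bracket_approx_inv n : approx (WQ_const n.+1%:R^-1).
Proof.
set u := WQ_const _; have n0 : n.+1%:R != 0 :> rat by rewrite pnatr_eq0.
have un : u * n.+1%:R = 1 by rewrite -WQ_const_nat -WQ_constM mulVf.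
have tn : theta u * n.+1%:R = 1.
  by rewrite -(rmorph_nat (@theta R)) -rmorphM un rmorph1.
have : approx (n.+1%:R * bracket (theta u)).
  apply: bracket_approxM; first exact: bracket_approx_nat.
  by rewrite theta_bracket subrr; exact: s_ideal0.
have -> : theta (n.+1%:R * bracket (theta u)) = 1.
  by rewrite rmorphM /= theta_bracket rmorph_nat mulrC.
rewrite bracket1 [_ * bracket _]mulrC => h.
have -> : u - bracket (theta u) = - (u * (bracket (theta u) * n.+1%:R - 1)).
  by rewrite mulrBr mulr1 mulrCA un mulr1 opprB.
exact/s_idealN/s_idealM.
Qed.

Lemma bracket_approx_const (q : rat) : approx (WQ_const q).
Proof.
rewrite -[q]divq_num_den WQ_constM; apply: bracket_approxM; last first.
  have := denq_gt0 q; case: (denq q) => // -[//|n] _.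
  exact: bracket_approx_inv.
case: (numq q) => n; last rewrite NegzE mulrNz.
  by rewrite [WQ_const _]WQ_const_nat; exact: bracket_approx_nat.
have -> : WQ_const (- n.+1%:R) = - n.+1%:R.
  by rewrite -WQ_const_nat /WQ_const monalgUN.
exact/bracket_approxN/bracket_approx_nat.
Qed.

(** Modulo the ideal generated by the s(x) the bracket is a ring morphism, and a
    section of theta: all that is left of w is [theta w]. *)
Lemma bracket_approx (w : WQ R) : approx w.
Proof.
rewrite [w]monalgE; elim/big_ind: _ => [|u v|p _].
- by rewrite raddf0 bracket0 subrr; exact: s_ideal0.
- exact: bracket_approxD.
have -> : << w@_p *g p >> = WQ_const w@_p * << p >>.
  by rewrite [RHS]ga_mulUU mulr1 mul1g.
apply: bracket_approxM; first exact: bracket_approx_const.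
exact: bracket_approx_pos.
Qed.

Lemma ker_theta_generated (w : WQ R) : theta w = 0 -> w \in s_ideal.
Proof. by move=> w0; have := bracket_approx w; rewrite w0 bracket0 subr0. Qed.

End KerGenerators.

(** * Universal property of Omega and the isomorphism *)

Section OmegaLift.
Variables (R : realType) (V : lmodType R) (e : R -> V).
Hypothesis he : omega_symbol e.

Let free_term (x a : R) : V := a *: e x.
Let free_term_additive x : zmod_morphism (free_term x).
Proof. by move=> a b; rewrite /free_term scalerBl. Qed.

HB.instance Definition _ x :=
  GRing.isZmodMorphism.Build R V (free_term x) (free_term_additive x).

Definition free_lift (w : {malg R[R]}) : V := \sum_(x <- msupp w) w@_x *: e x.

Lemma free_lift_zmod_morphism : zmod_morphism free_lift.
Proof. by move=> u v; exact: (msum_is_additive (fun x => free_term x) u v). Qed.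

HB.instance Definition _ :=
  GRing.isZmodMorphism.Build {malg R[R]} V free_lift free_lift_zmod_morphism.

Lemma free_liftU c x : free_lift << c *g x >> = c *: e x.
Proof. exact: (msumU (fun x => free_term x)). Qed.

Lemma free_lift_scalable : scalable free_lift.
Proof.
move=> a w; rewrite [w]monalgE scaler_sumr !(raddf_sum free_lift) scaler_sumr.
apply: eq_bigr => x _.
have -> : a *: << w@_x *g x >> = << a * w@_x *g x >> :> {malg R[R]}.
  by apply/malgP => k; rewrite mcoeffZ !mcoeffU mulrnAr.
by rewrite /= !free_liftU scalerA.
Qed.

HB.instance Definition _ :=
  GRing.isScalable.Build R {malg R[R]} V *:%R free_lift free_lift_scalable.

Lemma free_lift_rel v : omega_rel v -> free_lift v = 0.
Proof.
have symbE x : free_lift (symb x) = e x by rewrite free_liftU scale1r.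
case: he => hA hB hC [x|x y y0 y1|x x0]; rewrite (raddfB free_lift) /=.
- by rewrite !symbE hA subrr.
- by rewrite !(raddfD free_lift) /= !free_lift_scalable /= !symbE hB // subrr.
- by rewrite (raddfN free_lift) /= free_lift_scalable /= !symbE hC // subrr.
Qed.

Lemma free_lift_submod v : v \in submod_gen (@omega_rel R) -> free_lift v = 0.
Proof.
move=> /asboolP[t [Pt ->]]; rewrite raddf_sum big_seq big1 // => p /Pt hp.
by rewrite /= free_lift_scalable free_lift_rel // scaler0.
Qed.

(** The relations on e are an argument so that linearity can be inferred from the
    term alone. *)
Definition omega_lift of omega_symbol e := fun c : Omega R =>
  free_lift (repr (c : {ideal_quot (submod_gen (@omega_rel R))})).

Lemma omega_liftE v :
  omega_lift he (lmod_class (@omega_rel R) v) = free_lift v.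
Proof.
apply/eqP; rewrite -subr_eq0 -raddfB /=; apply/eqP/free_lift_submod.
by rewrite Quotient.idealrBE; apply/eqP; exact: lmod_class_repr.
Qed.

Lemma omega_lift_zmod_morphism : zmod_morphism (omega_lift he).
Proof.
move=> c d; rewrite -[c]lmod_class_repr -[d]lmod_class_repr -raddfB.
by rewrite !omega_liftE raddfB.
Qed.

Lemma omega_lift_scalable : scalable (omega_lift he).
Proof.
move=> a c; rewrite -[c]lmod_class_repr -lmod_class_is_scalable.
by rewrite !omega_liftE free_lift_scalable.
Qed.

HB.instance Definition _ := GRing.isZmodMorphism.Build
  (Omega R) V (omega_lift he) omega_lift_zmod_morphism.
HB.instance Definition _ := GRing.isScalable.Build
  R (Omega R) V *:%R (omega_lift he) omega_lift_scalable.

Lemma omega_lift_eps x : (omega_lift he) (eps x) = e x.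
Proof. by rewrite omega_liftE free_liftU scale1r. Qed.

End OmegaLift.

Section Generators.
Variable R : realType.

Lemma eps_symbol : omega_symbol (@eps R).
Proof.
have relE a b : omega_rel (a - b) ->
    lmod_class (@omega_rel R) a = lmod_class (@omega_rel R) b.
  move=> hab; apply/eqP; rewrite -[_ == _]Quotient.idealrBE; apply/asboolP.
  exists [:: (1, a - b)]; split; last by rewrite big_seq1 scale1r.
  by move=> p; rewrite inE => /eqP ->.
split=> [x|x y y0 y1|x x0].
- exact/relE/OmegaA.
- have /relE := OmegaB x y0 y1.
  by rewrite 2!(raddfD (lmod_class (@omega_rel R))) /= !lmod_class_is_scalable.
- have /relE := OmegaC x0.
  by rewrite (raddfN (lmod_class (@omega_rel R))) /= lmod_class_is_scalable.
Qed.

Lemma omega_ext (V : lmodType R) (f g : {linear Omega R -> V}) :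
  (forall x, f (eps x) = g (eps x)) -> f =1 g.
Proof.
move=> fg c; rewrite -[c]lmod_class_repr; move: (repr _) => v.
rewrite [v]monalgE !raddf_sum; apply: eq_bigr => x _ /=.
have -> : lmod_class (@omega_rel R) << v@_x *g x >> = v@_x *: eps x.
  rewrite -lmod_class_is_scalable; congr lmod_class.
  by apply/malgP => k; rewrite mcoeffZ !mcoeffU mulr_natr.
by rewrite !linearZ /= fg.
Qed.

(** The classes of the s(x) span Ker(theta)/Ker(theta)^2 over R, by
    [ker_theta_generated]. *)
Lemma ker_class_ext (V : lmodType R) (f g : {linear Ker_mod_sq R -> V}) :
  (forall x, f (s_class x) = g (s_class x)) -> f =1 g.
Proof.
move=> fg c; rewrite -[c]ker_class_repr; move: (repr _) => k.
have /eqP/ker_theta_generated/asboolP[t [Pt kt]] := valP k.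
elim: t k Pt kt => [|[a v] t ih] k Pt kt.
  have -> : k = 0 by apply: ker_val_inj; rewrite [LHS]kt big_nil.
  by rewrite !raddf0.
have [x vx] : exists x, v = s_elt x by apply: (Pt (a, v)); rewrite inE eqxx.
pose l := ker_act a (MkKer (s_in_ker x)).
have [m km] : exists m, k = l + m by exists (k - l); rewrite addrC subrK.
have cl : ker_class l = theta a *: s_class x by rewrite scale_theta.
rewrite km (raddfD (@ker_class R)) /= cl 2!raddfD /= 2!linearZ /= fg.
congr (_ + _); apply: ih => [p pt|]; first by apply: Pt; rewrite inE pt orbT.
move: kt; rewrite km [val _]ker_valD big_cons /= vx.
exact: addrI.
Qed.

Lemma omega_iso : exists f : {linear Omega R -> Ker_mod_sq R},
  bijective f /\ forall x, f (eps x) = s_class x.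
Proof.
pose f : {linear _ -> _} := omega_lift (@s_class_symbol R).
pose g : {linear _ -> _} := class_lift eps_symbol.
have fE x : f (eps x) = s_class x by exact: omega_lift_eps.
have gE x : g (s_class x) = eps x by exact: class_lift_symbol.
exists f; split=> //; exists g => c.
  by apply: (omega_ext (f := g \o f) (g := idfun)) => x /=; rewrite fE gE.
by apply: (ker_class_ext (f := f \o g) (g := idfun)) => x /=; rewrite gE fE.
Qed.

End Generators.

(** * Extending the p-adic valuation to the positive reals *)

Section SeparatingFunctional.
Variables (F : fieldType) (U : lmodType F).
Local Open Scope classical_set_scope.

Definition subspace (N : set U) : Prop :=
  N 0 /\ forall c u v, N u -> N v -> N (c *: u + v).

(** Zorn's lemma is applied to the sets N for which N0 `|` N, rather than N, is a
    subspace avoiding a: this way the empty chain causes no trouble. *)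
Lemma maximal_avoiding_subspace (N0 : set U) (a : U) :
  subspace N0 -> ~ N0 a ->
  exists N, [/\ subspace N, N0 `<=` N, ~ N a &
    forall M, subspace M -> N `<=` M -> ~ M a -> M `<=` N].
Proof.
move=> [N00 N0lin] N0a.
pose P : set (set U) := fun N => subspace (N0 `|` N) /\ ~ (N0 `|` N) a.
have [|N [[PN PNa] Nmax]] := @Zorn_bigcup _ P.
  move=> C CP Ctot; split; last first.
    by case=> // -[X CX Xa]; have [_] := CP X CX; apply; right.
  split=> [|c u v]; first by left.
  have inX X w : C X -> (N0 `|` X) w -> (N0 `|` \bigcup_(Y in C) Y) w.
    by move=> CX [|Xw]; [left | right; exists X].
  have lin X : C X -> (N0 `|` X) u -> (N0 `|` X) v ->
      (N0 `|` \bigcup_(Y in C) Y) (c *: u + v).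
    move=> CX Xu Xv; have [[_ h] _] := CP X CX.
    exact: inX (CX) (h c u v Xu Xv).
  case=> [N0u|[X CX Xu]] [N0v|[Y CY Yv]].
  - by left; exact: N0lin.
  - by apply: (lin Y); [|left|right].
  - by apply: (lin X); [|right|left].
  - have [XY|YX] := Ctot X Y CX CY.
      by apply: (lin Y); [|right; exact: XY|right].
    by apply: (lin X); [|right|right; exact: YX].
exists (N0 `|` N); split; [exact: PN|by move=> w; left|exact: PNa|].
move=> M Mlin NM Ma u Mu; right; apply: contrapT => Nu.
apply: (Nmax M); last first.
  have N0M : N0 `|` M = M.
    by apply/seteqP; split=> [w [N0w|//]|w]; [apply: NM; left | right].
  by rewrite /P N0M.
split; first by move=> w Nw; apply: NM; right.
by move=> MN; exact/Nu/MN.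
Qed.

(** A subspace N maximal among those avoiding a is a complement of the line
    spanned by a: if u is not in N, then N + F u contains a.  The functional is
    the coordinate along a. *)
Lemma separating_functional (N0 : set U) (a : U) : subspace N0 -> ~ N0 a ->
  exists f : U -> F, [/\ forall c u v, f (c *: u + v) = c * f u + f v,
    f a = 1 & forall u, N0 u -> f u = 0].
Proof.
move=> N0lin N0a.
have [N [[N00 Nlin] N0N Na Nmax]] := maximal_avoiding_subspace N0lin N0a.
have coord u : exists c, N (u - c *: a).
  apply: contrapT => h.
  pose M : set U := fun w => exists c, N (w - c *: u).
  have Mlin : subspace M.
    split=> [|k v w [c Nv] [d Nw]]; first by exists 0; rewrite scale0r subr0.
    exists (k * c + d).
    have -> : k *: v + w - (k * c + d) *: u = k *: (v - c *: u) + (w - d *: u).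
      by rewrite scalerBr scalerDl scalerA opprD addrACA.
    exact: Nlin.
  have NM : N `<=` M by move=> w Nw; exists 0; rewrite scale0r subr0.
  have [[c Nc]|Ma] := pselect (M a).
    have [c0|c0] := eqVneq c 0; first by rewrite c0 scale0r subr0 in Nc.
    apply: h; exists c^-1.
    have -> : u - c^-1 *: a = (- c^-1) *: (a - c *: u) + 0.
      by rewrite addr0 scalerBr !scaleNr opprK scalerA mulVf // scale1r addrC.
    exact: Nlin.
  apply: h; exists 0; rewrite scale0r subr0; apply: (Nmax M) => //.
  by exists 1; rewrite scale1r subrr.
have coord_uniq u c d : N (u - c *: a) -> N (u - d *: a) -> c = d.
  move=> Nc Nd; apply/eqP; rewrite -subr_eq0; apply/negPn/negP => cd.
  apply: Na.
  have -> : a = (c - d)^-1 *: ((-1) *: (u - c *: a) + (u - d *: a)) + 0.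
    rewrite addr0 scaleN1r opprB addrA subrK -scalerBl scalerA mulVf //.
    by rewrite scale1r.
  by apply: (Nlin) => //; exact: Nlin.
have [f fN] := choice coord.
exists f; split.
- move=> c u v; apply: (coord_uniq (c *: u + v)) => //.
  have -> : c *: u + v - (c * f u + f v) *: a =
     c *: (u - f u *: a) + (v - f v *: a).
    by rewrite scalerBr scalerDl scalerA opprD addrACA.
  exact: Nlin.
- by apply: (coord_uniq a) => //; rewrite scale1r subrr.
- by move=> u N0u; apply: (coord_uniq u) => //; rewrite scale0r subr0; exact: N0N.
Qed.

End SeparatingFunctional.

Section RationalScalarsOnReals.
Variable R : realType.

(** A copy of R, on which the scalars are rational: R already is a module over
    itself. *)
Definition ratmod : Type := R.
HB.instance Definition _ := GRing.Zmodule.on ratmod.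

Definition ratmod_scale (q : rat) (x : ratmod) : ratmod := ratr q * (x : R).

Lemma ratmod_scaleA a b x :
  ratmod_scale a (ratmod_scale b x) = ratmod_scale (a * b) x.
Proof. by rewrite /ratmod_scale mulrA rmorphM. Qed.

Lemma ratmod_scale1 : left_id 1 ratmod_scale.
Proof. by move=> x; rewrite /ratmod_scale rmorph1 mul1r. Qed.

Lemma ratmod_scaleDr : right_distributive ratmod_scale +%R.
Proof. by move=> a x y; rewrite /ratmod_scale mulrDr. Qed.

Lemma ratmod_scaleDl x : {morph ratmod_scale^~ x : a b / a + b}.
Proof. by move=> a b; rewrite /ratmod_scale rmorphD mulrDl. Qed.

HB.instance Definition _ := GRing.Zmodule_isLmodule.Build rat ratmod
  ratmod_scaleA ratmod_scale1 ratmod_scaleDr ratmod_scaleDl.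

(** The Q-span of the logarithms of the positive integers prime to p. *)
Definition log_pprime (p : nat) : set ratmod := fun x =>
  exists n a b : nat, [/\ (0 < n)%N, coprime p a, coprime p b &
    [/\ (0 < a)%N, (0 < b)%N & x *+ n = ln (a%:R : R) - ln b%:R]].

Lemma ln_natM (a b : nat) : (0 < a)%N -> (0 < b)%N ->
  ln ((a * b)%:R : R) = ln a%:R + ln b%:R.
Proof. by move=> a0 b0; rewrite natrM lnM ?posrE ?ltr0n. Qed.

Lemma ln_natX (a n : nat) : (0 < a)%N -> ln ((a ^ n)%:R : R) = ln a%:R *+ n.
Proof. by move=> a0; rewrite natrX lnXn ?ltr0n. Qed.

Lemma log_pprime_subspace p : subspace (log_pprime p).
Proof.
have zero : log_pprime p 0.
  by exists 1%N, 1%N, 1%N; rewrite coprimen1 subrr mul0rn; split.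
split=> //.
have add x y : log_pprime p x -> log_pprime p y -> log_pprime p (x + y).
  move=> [n [a [b [n0 pa pb [a0 b0 xE]]]]] [m [c [d [m0 pc pd [c0 d0 yE]]]]].
  exists (n * m)%N, (a ^ m * c ^ n)%N, (b ^ m * d ^ n)%N.
  rewrite muln_gt0 n0 m0 !coprimeMr !coprimeXr //.
  rewrite !muln_gt0 !expn_gt0 a0 b0 c0 d0.
  split=> //; split=> //; rewrite !ln_natM ?expn_gt0 ?a0 ?b0 ?c0 ?d0 //.
  rewrite !ln_natX // mulrnDl mulrnA xE mulnC mulrnA yE !mulrnBl.
  by rewrite opprD addrACA.
have opp x : log_pprime p x -> log_pprime p (- x).
  move=> [n [a [b [n0 pa pb [a0 b0 xE]]]]]; exists n, b, a.
  by split=> //; split=> //; rewrite mulNrn xE opprB.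
move=> q u v pu pv; apply: (add) => // {pv}.
have nat_mul k : log_pprime p (u *+ k).
  elim: k => [|k ih]; first by rewrite mulr0n; exact: zero.
  by rewrite mulrS; exact: add.
have int_mul : log_pprime p (u *~ numq q).
  case: (numq q) => k; first exact: nat_mul.
  by rewrite NegzE mulrNz; exact/opp/nat_mul.
have : (q *: u) *+ `|denq q| = u *~ numq q.
  rewrite -[LHS]mulr_natr natr_absz gtr0_norm ?denq_gt0 //.
  rewrite -[LHS]/(ratr q * (u : R) * (denq q)%:~R).
  by rewrite /ratr mulrAC divfK ?intr_eq0 ?denq_neq0 // mulrzl.
move=> qE; case: int_mul => n [a [b [n0 pa pb [a0 b0 xE]]]].
exists (`|denq q| * n)%N, a, b; rewrite muln_gt0 absz_gt0 denq_neq0 n0.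
by split=> //; split=> //; rewrite mulrnA qE.
Qed.

(** Otherwise p ^ n * b = a with n > 0 and a prime to p. *)
Lemma log_prime_free p : prime p -> ~ log_pprime p (ln (p%:R : R)).
Proof.
move=> pp [n [a [b [n0 pa pb [a0 b0]]]]]; have p0 := prime_gt0 pp.
have pn0 : (0 < p ^ n)%N by rewrite expn_gt0 p0.
move=> /eqP; rewrite eq_sym subr_eq -ln_natX // -ln_natM // => /eqP.
move=> /ln_inj; rewrite !posrE !ltr0n a0 muln_gt0 pn0 b0.
move=> /(_ isT isT)/eqP; rewrite eqr_nat => /eqP aE.
by move: pa; rewrite prime_coprime // aE dvdn_mulr // dvdn_exp.
Qed.

(** An extension to R of the p-adic valuation, read through the logarithm. *)
Lemma padic_log p : prime p -> exists chi : R -> R,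
  [/\ {morph chi : x y / x + y}, chi (ln p%:R) = 1 &
      forall m : nat, (0 < m)%N -> coprime p m -> chi (ln m%:R) = 0].
Proof.
move=> pp.
have [f [flin fp f0]] :=
  separating_functional (log_pprime_subspace p) (log_prime_free pp).
exists (fun x => ratr (f x)); split.
- by move=> x y; rewrite -[x in LHS](scale1r (x : ratmod)) flin mul1r rmorphD.
- by rewrite fp rmorph1.
- move=> m m0 pm; rewrite f0 ?rmorph0 //; exists 1%N, m, 1%N.
  by split=> //; rewrite ?coprimen1 // ln1 subr0.
Qed.

End RationalScalarsOnReals.

(** * Omega is infinite dimensional *)

Section TriangularFamily.
Variables (F : fieldType) (V : lmodType F).
Variables (v : nat -> V) (f : nat -> {linear V -> F^o}).

(** In dimension n, the vectors v 0, ..., v n satisfy a nontrivial linear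
    relation.  At the largest index i with a nonzero coefficient, f i kills every
    term but the i-th. *)
Lemma triangular_infinite_dimensional :
  (forall k, f k (v k) != 0) -> (forall j k, (j < k)%N -> f k (v j) = 0) ->
  infinite_dimensional V.
Proof.
move=> fdiag flow n [r rlin rbij].
pose M : 'M[F]_(n.+1, n) := \matrix_i r (v i).
have : kermx M != 0.
  by rewrite -mxrank_eq0 mxrank_ker subn_eq0 -ltnNge ltnS rank_leq_col.
move=> /rowV0Pn[u]; rewrite sub_kermx => /eqP uM u0.
have r0 : r 0 = 0.
  by have := rlin (-1) 0 0; rewrite scaler0 addr0 scaleN1r addNr.
have rsum : r (\sum_(i < n.+1) u 0 i *: v i) = \sum_(i < n.+1) u 0 i *: r (v i).
  elim/big_rec2: _ => [//|i x y _ <-]; exact: rlin.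
have vdep : \sum_(i < n.+1) u 0 i *: v i = 0.
  apply: (bij_inj rbij); rewrite rsum r0 -[RHS]uM mulmx_sum_row.
  by apply: eq_bigr => i _; rewrite rowK.
have /rV0Pn[i0 ui0] := u0.
case: (@arg_maxnP _ i0 (fun i => u 0 i != 0) (@nat_of_ord _)) => // i ui imax.
have : f i (\sum_(i < n.+1) u 0 i *: v i) = 0 by rewrite vdep raddf0.
rewrite raddf_sum (bigD1 i) //= big1 => [|j ji]; last first.
  rewrite linearZ /=; case: (ltngtP j i) => [jlt|jgt|/val_inj jE].
  - by rewrite flow // scaler0.
  - have [->|/imax] := eqVneq (u 0 j) 0; first by rewrite scale0r.
    by move=> /=; rewrite leqNgt jgt.
  - by rewrite jE eqxx in ji.
rewrite addr0 linearZ /= => /eqP; rewrite mulf_eq0 (negPf ui) /=.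
by rewrite (negPf (fdiag i)).
Qed.

End TriangularFamily.

Section LogDerivation.
Variables (R : realFieldType) (D : R -> R).
Hypothesis DM : forall x y, D (x * y) = x * D y + y * D x.

Lemma log_derivation1 : D 1 = 0.
Proof. have := DM 1 1; rewrite !mul1r; lra. Qed.

Lemma log_derivationN x : D (- x) = - D x.
Proof.
have D1 : D (-1) = 0.
  have := DM (-1) (-1); rewrite mulrNN mul1r log_derivation1; lra.
by rewrite -mulN1r DM D1 mulr0 addr0 mulN1r.
Qed.

(** Expand D on x = (1 - y) u and 1 - x - y = (1 - y) (1 - u), where
    u = x / (1 - y), and on - x = y v and x + y = y (1 - v), where v = - x / y:
    (B) then is a linear combination of these four identities.  (C) follows in
    the same way from 1 = x (1 / x) and x - 1 = x (1 - 1 / x). *)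
Lemma log_derivation_symbol :
  omega_symbol (fun x => - (D x + D (1 - x)) : R^o).
Proof.
split=> [x|x y y0 y1|x x0].
- by rewrite subKr addrC.
- have y1' : 1 - y != 0 by rewrite subr_eq0 eq_sym.
  set u := x / (1 - y); set v := - (x / y); rewrite /GRing.scale /=.
  have h1 := DM (1 - y) u; have h2 := DM (1 - y) (1 - u).
  have h3 := DM y v; have h4 := DM y (1 - v).
  have e1 : (1 - y) * u = x by rewrite /u; field.
  have e2 : (1 - y) * (1 - u) = 1 - (x + y) by rewrite /u; field.
  have e3 : y * v = - x by rewrite /v; field.
  have e4 : y * (1 - v) = x + y by rewrite /v; field.
  rewrite e1 in h1; rewrite e2 in h2; rewrite e3 log_derivationN in h3.
  rewrite e4 in h4.
  move: h1 h2 h3 h4; clear; lra.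
- rewrite /GRing.scale /=.
  have h1 := DM x (1 / x); have h2 := DM x (1 - 1 / x).
  have e1 : x * (1 / x) = 1 by field.
  have e2 : x * (1 - 1 / x) = - (1 - x) by field.
  rewrite e1 log_derivation1 in h1; rewrite e2 log_derivationN in h2.
  move: h1 h2; lra.
Qed.

End LogDerivation.

Section InfiniteDimension.
Variable R : realType.

Lemma character_log_derivation (chi : R -> R) :
  {morph chi : x y / x + y} ->
  let D := fun x => x * chi (ln `|x|) in
  forall x y, D (x * y) = x * D y + y * D x.
Proof.
move=> chiD D x y; rewrite /D.
have [->|x0] := eqVneq x 0; first by rewrite !mul0r mulr0 addr0.
have [->|y0] := eqVneq y 0; first by rewrite mulr0 !mul0r mulr0 addr0.
rewrite normrM lnM ?posrE ?normr_gt0 // chiD; ring.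
Qed.

(** The value at eps(q) involves the valuations of q and q - 1 only. *)
Lemma padic_functional (p : nat) : prime p ->
  exists f : {linear Omega R -> R^o},
    f (eps p%:R) != 0 /\ forall q : nat, (1 < q < p)%N -> f (eps q%:R) = 0.
Proof.
move=> pp; have [chi [chiD chip chi0]] := padic_log R pp.
have he := log_derivation_symbol (character_log_derivation chiD).
have p1 := prime_gt1 pp.
have val q : (1 < q)%N -> omega_lift he (eps q%:R) =
    - (q%:R * chi (ln q%:R) - q.-1%:R * chi (ln q.-1%:R)).
  move=> q1; rewrite omega_lift_eps normr_nat.
  have -> : 1 - q%:R = - q.-1%:R :> R.
    by rewrite -[in q%:R](prednK (ltnW q1)) -natr1 opprD addrCA subrr addr0.
  by rewrite normrN normr_nat mulNr.
have cop q : (0 < q < p)%N -> chi (ln q%:R) = 0.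
  move=> /andP[q0 qp]; apply: chi0 => //.
  by rewrite prime_coprime // gtnNdvd.
have pred q : (1 < q)%N -> (0 < q.-1 < q)%N.
  by case: q => [|[|q]] // _; rewrite /= ltnS leqnn.
exists (omega_lift he); split.
  rewrite /= (val p p1) chip (cop p.-1) ?pred //.
  by rewrite mulr0 subr0 mulr1 oppr_eq0 pnatr_eq0 -lt0n prime_gt0.
move=> q /andP[q1 qp]; have /andP[q0 qlt] := pred q q1.
rewrite /= (val q q1) (cop q) ?(ltnW q1) // (cop q.-1) ?q0 ?(ltn_trans qlt) //.
by rewrite !mulr0 subrr oppr0.
Qed.

Fixpoint prime_seq (k : nat) : nat :=
  if k is k'.+1 then s2val (prime_above (prime_seq k')) else 2.

Lemma prime_seq_prime k : prime (prime_seq k).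
Proof. by case: k => //= k; case: prime_above. Qed.

Lemma prime_seq_lt j k : (j < k)%N -> (prime_seq j < prime_seq k)%N.
Proof.
have step i : (prime_seq i < prime_seq i.+1)%N by rewrite /=; case: prime_above.
elim: k => // k ih; rewrite ltnS leq_eqVlt => /orP[/eqP->|/ih jk] //.
exact: ltn_trans jk _.
Qed.

Lemma omega_infinite_dimensional : infinite_dimensional (Omega R).
Proof.
have [f fP] := choice (fun k => padic_functional (prime_seq_prime k)).
apply: (@triangular_infinite_dimensional _ _
  (fun k => eps (prime_seq k)%:R) f) => [k|j k jk].
  by have [] := fP k.
by apply: (fP k).2; rewrite prime_gt1 ?prime_seq_prime // prime_seq_lt.
Qed.

End InfiniteDimension.

Theorem theorem4p5 (R : realType) :
  (exists f : {linear Omega R -> Ker_mod_sq R},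
      bijective f /\ forall x : R, f (eps x) = s_class x) /\
  infinite_dimensional (Omega R).
Proof. by split; [exact: omega_iso | exact: omega_infinite_dimensional]. Qed.
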